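(* Let $(G,\omega,g)$ be a hermitian Lie group with Lie algebra $\mathfrak g$ (with $\omega,g$ left-invariant) and Chern-Ricci operator $P\ne0$, and let $c\in\mathbb R$. Then the following conditions are equivalent. (i) $(\omega,g)$ is a Chern-Ricci soliton with cosmological constant $c$. (ii) $P=cI+D$ for some $D\in\mathrm{Der}(\mathfrak g)$. (iii) The eigenvalues of $P$ are all either equal to $0$ or $c$, the kernel $\mathfrak k=\mathrm{Ker}\,P$ is an abelian ideal of $\mathfrak g$ and its orthogonal complement $\mathfrak k^\perp$ (i.e. the $c$-eigenspace of $P$) is a Lie subalgebra of $\mathfrak g$ (in particular, $\mathfrak g$ is the semidirect product $\mathfrak g=\mathfrak k^\perp\ltimes\mathfrak k$ and $c$ is nonzero).
   Context: A left-invariant hermitian structure on a Lie group with Lie algebra $\mathfrak g$, $\dim\mathfrak g=2n$, is identified with a pair $(\omega,g)$, with $\omega$ a non-degenerate $2$-form and $g$ an inner product on $\mathfrak g$ such that $J$ defined by $\omega=g(J\cdot,\cdot)$ satisfies $J^2=-I$ and $[JX,JY]-[X,Y]-J[JX,Y]-J[X,JY]=0$ for all $X,Y\in\mathfrak g$. Its Chern-Ricci form is $$p(X,Y)=-\tfrac12\mathrm{tr}(J\,\mathrm{ad}[X,Y])+\tfrac12\mathrm{tr}(\mathrm{ad}(J[X,Y])),\qquad X,Y\in\mathfrak g,$$ which is a $(1,1)$-form since $J$ is integrable, and its Chern-Ricci operator $P\in\mathrm{End}(\mathfrak g)$ is defined by $p=\omega(P\cdot,\cdot)$; $P$ is $g$-symmetric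 and commutes with $J$. Orthogonality is with respect to $g$, and $\mathrm{Der}(\mathfrak g)$ denotes the derivations of $\mathfrak g$. Definition. $(\omega,g)$ is a Chern-Ricci soliton with cosmological constant $c\in\mathbb R$ if $P=cI+\frac12(D+D^t)$ for some $D\in\mathrm{Der}(\mathfrak g)$ with $DJ=JD$ (transpose relative to $g$). *)

(* Defs.v *)
From HB Require Import structures.
From mathcomp Require Import all_boot all_order all_algebra.
From mathcomp Require Import reals.
Set Implicit Arguments.
Unset Strict Implicit.
Unset Printing Implicit Defensive.
Import Order.TTheory GRing.Theory Num.Theory.
Local Open Scope ring_scope.

Section LieAlgebra.
Context {R : realType} {V : vectType R}.
Implicit Types (br : {bilinear V -> V -> V}) (U : {vspace V}).

Definition lie_bracket br : Prop :=
  (forall x, br x x = 0) /\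
  (forall x y z, br x (br y z) + br y (br z x) + br z (br x y) = 0).

Definition ad br (x : V) : 'End(V) := linfun (br x).

Definition derivation br (D : 'End(V)) : Prop :=
  forall x y, D (br x y) = br (D x) y + br x (D y).

Definition lie_subalgebra br U : Prop :=
  {in U & U, forall x y, br x y \in U}.

Definition lie_ideal br U : Prop :=
  forall x y, y \in U -> br x y \in U.

Definition lie_abelian br U : Prop :=
  {in U & U, forall x y, br x y = 0}.

(* Internal semidirect product [fullv = H |>< K], with [K] the ideal. *)
Definition lie_semidirect br (H K : {vspace V}) : Prop :=
  [/\ lie_subalgebra br H, lie_ideal br K,
      (H + K)%VS = fullv & (H :&: K)%VS = 0%VS].

(* The basis is arbitrary: the trace does not depend on it. *)
Definition lftrace (f : 'End(V)) : R :=
  \tr (passmx.mxof (vbasis {:V}) (vbasis {:V}) f).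

End LieAlgebra.

Section Hermitian.
Context {R : realType} {V : vectType R}.
Implicit Types (br : {bilinear V -> V -> V}) (w : {skew_symmetric V}).
Implicit Types (g : {dot V for idfun}) (J P D : 'End(V)).

(* The second clause determines [J] from [w] and [g]. *)
Definition hermitian_structure br w g J : Prop :=
  [/\ nondegenerate w,
      forall x y, w x y = g (J x) y,
      (J \o J)%VF = - \1%VF
    & forall x y,
        br (J x) (J y) - br x y - J (br (J x) y) - J (br x (J y)) = 0].

Definition chern_ricci_form br J (x y : V) : R :=
  - 2^-1 * lftrace (J \o ad br (br x y))%VF
  + 2^-1 * lftrace (ad br (J (br x y))).

(* Since [w] is nondegenerate, exactly one [P] satisfies this. *)
Definition chern_ricci_operator br w J P : Prop :=
  forall x y, chern_ricci_form br J x y = w (P x) y.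

Definition transpose_of g D (Dt : 'End(V)) : Prop :=
  forall x y, g (D x) y = g x (Dt y).

Definition chern_ricci_soliton br g J P (c : R) : Prop :=
  exists D Dt : 'End(V), [/\ derivation br D, (D \o J)%VF = (J \o D)%VF,
    transpose_of g D Dt & P = c *: \1%VF + 2^-1 *: (D + Dt)].

End Hermitian.

(* Main.v *)
(* With S = P - c, the soliton equation reads S = (D + D^t)/2. A derivation D
   commuting with J kills the linear form X |-> - tr(J ad X)/2 + tr(ad JX)/2
   whose value at [X, Y] is p(X, Y), which translates into P D = - D^t P. Hence
   the symmetric operator P S is, up to a factor -2, the commutator [P, D];
   as it commutes with P, its square has trace 0, so P S = 0. Then D commutes
   with P, so it is normal; the transpose of a normal derivation being
   a derivation, S is one too. Now P(P - c) = 0 and P - c is the derivation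
   equal to -c on Ker P and to 0 on its orthogonal complement, which amounts to
   Ker P being an abelian ideal and its complement a subalgebra.

   That p is of type (1,1), so that P is symmetric and commutes with J, is
   a trace computation from the vanishing of the Nijenhuis tensor. *)
Require Import Defs.
From HB Require Import structures.
From mathcomp Require Import all_boot all_order all_algebra.
From mathcomp Require Import reals.
From mathcomp Require Import ring lra complex.
Set Implicit Arguments.
Unset Strict Implicit.
Unset Printing Implicit Defensive.
Import Order.TTheory GRing.Theory Num.Theory.
Local Open Scope ring_scope.

(** * Inner products and orthonormal frames *)

Section Dot.
Context {R : realType} {V : vectType R}.
Variable g : {dot V for idfun}.

Lemma dotC x y : g x y = g y x.
Proof. by rewrite hermC expr0 mul1r. Qed.

Lemma dotDl x y z : g (x + y) z = g x z + g y z.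
Proof. exact: linearDl. Qed.

Lemma dotBl x y z : g (x - y) z = g x z - g y z.
Proof. exact: linearBl. Qed.

Lemma dotDr x y z : g x (y + z) = g x y + g x z.
Proof. exact: linearD. Qed.

Lemma dotBr x y z : g x (y - z) = g x y - g x z.
Proof. exact: linearB. Qed.

Lemma dotZl a x y : g (a *: x) y = a * g x y.
Proof. exact: linearZl_LR. Qed.

Lemma dotZr a x y : g x (a *: y) = a * g x y.
Proof. by rewrite dotC dotZl dotC. Qed.

Lemma dotNl x y : g (- x) y = - g x y.
Proof. exact: linearNl. Qed.

Lemma dotNr x y : g x (- y) = - g x y.
Proof. exact: linearN. Qed.

Lemma dot_gt0 x : x != 0 -> 0 < g x x.
Proof. exact: neq0_dnorm_gt0. Qed.

Lemma dot_ge0 x : 0 <= g x x.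
Proof. by have [->|/dot_gt0/ltW//] := eqVneq x 0; rewrite linear0r. Qed.

Lemma dot_eq0 x : g x x = 0 -> x = 0.
Proof.
by move=> gx0; apply/eqP/negPn/negP => /dot_gt0; rewrite gx0 ltxx.
Qed.

(** Pairing with an arbitrary vector also turns identities in [V] into scalar ones, where [ring],
    [field] and [lra] apply. *)
Lemma dot_inj x y : (forall z, g x z = g y z) -> x = y.
Proof.
move=> exy; apply/eqP; rewrite -subr_eq0; apply/eqP/dot_eq0.
by rewrite dotBl exy subrr.
Qed.

Lemma transpose_of_sym f ft : transpose_of g f ft -> transpose_of g ft f.
Proof. by move=> fT x y; rewrite dotC -fT dotC. Qed.

Lemma mem_dot_orthov1 x y : (x \in orthov g <[y]>) = (g x y == 0).
Proof. exact: mem_orthov1. Qed.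

(* Gram-Schmidt. Sums over [s] only ever use the expansion property. *)
Lemma orthonormal_frame (U : {vspace V}) :
  exists2 s : seq V, {subset s <= U} &
    {in U, forall x, x = \sum_(e <- s) g x e *: e}.
Proof.
have [n] := ubnP (\dim U); elim: n U => // n IHn U /ltnSE leUn.
have [->|U_neq0] := eqVneq U 0%VS.
  by exists [::] => // x; rewrite memv0 big_nil => /eqP.
set v := vpick U; have vU : v \in U by apply: memv_pick.
have v_neq0 : v != 0 by rewrite vpick0.
pose e := (Num.sqrt (g v v))^-1 *: v.
have eU : e \in U by apply: memvZ.
have gee : g e e = 1.
  rewrite dotZl dotZr mulrA -invfM -expr2 sqr_sqrtr ?dot_ge0// mulVf//.
  by rewrite gt_eqF// dot_gt0.
(* The vector [e] of [U] is not orthogonal to itself, so cutting by its orthogonal lowers the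
   dimension by one. *)
have ltU : (\dim (U :&: orthov g <[e]>) < n)%N.
  apply: leq_trans leUn; rewrite -eq_dim_orthov1.
    by rewrite prednK// lt0n dimv_eq0.
  apply/mem_orthovPn; exists e => //.
  by change (g e e != 0); rewrite gee oner_eq0.
have [s sU sP] := IHn _ ltU.
exists (e :: s) => [x|x xU].
  by rewrite inE => /orP[/eqP->//|/sU]; rewrite memv_cap => /andP[].
have x'U : x - g x e *: e \in (U :&: orthov g <[e]>)%VS.
  rewrite memv_cap rpredB ?memvZ//= mem_dot_orthov1 dotBl dotZl gee mulr1.
  by rewrite subrr.
rewrite big_cons; apply/eqP; rewrite addrC -subr_eq {1}(sP _ x'U); apply/eqP.
rewrite !big_seq; apply: eq_bigr => e' /sU; rewrite memv_cap => /andP[_].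
rewrite mem_dot_orthov1 dotC => /eqP gee'.
by rewrite dotBl dotZl gee' mulr0 subr0.
Qed.

End Dot.

(** * The action of endomorphisms on bilinear maps *)

Section Act.
Context {R : realType} {V : vectType R}.

(* The natural action of gl(V) on bilinear maps: [f] is a derivation of [b]
   exactly when it annihilates [b]. *)
Definition gl_act (f : 'End(V)) (b : V -> V -> V) x y :=
  f (b x y) - b (f x) y - b x (f y).

Fact gl_act_bilinear f (b : {bilinear V -> V -> V}) :
  bilinear_for *:%R *:%R (gl_act f b).
Proof.
have rearr (t1 t2 t3 t4 t5 t6 : V) :
    t1 + t2 - (t3 + t4) - (t5 + t6) = t1 - t3 - t5 + (t2 - t4 - t6).
  by rewrite !opprD [t1 + t2 + _]addrACA [LHS]addrACA.
split=> [u|u] a x y; rewrite /gl_act /=.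
  by rewrite !linearPl ![f (a *: _ + _)]linearP linearPl !scalerBr rearr.
by rewrite ![f (a *: _ + _)]linearP ![b _ (a *: _ + _)]linearP
  [f (a *: _ + _)]linearP !scalerBr rearr.
Qed.

(** With this instance [gl_act f b] can itself be acted upon. *)
HB.instance Definition _ f (b : {bilinear V -> V -> V}) :=
  bilinear_isBilinear.Build R V V V *:%R *:%R
    (gl_act f b) (gl_act_bilinear f b).

End Act.

(** * Traces and norms computed in a frame *)

Section Frame.
Context {R : realType} {V : vectType R}.
Variable g : {dot V for idfun}.

Lemma derivation_gl_act (br : {bilinear V -> V -> V}) D :
  derivation br D <-> forall x y, gl_act D br x y = 0.
Proof.
split=> DP x y; first by rewrite /gl_act DP addrAC addrK subrr.
by apply/eqP; rewrite -subr_eq0 opprD addrA; apply/eqP/DP.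
Qed.

(** The action represents the Lie algebra gl(V): the commutator of two actions is the action of the
    commutator. *)
Lemma gl_act_comm (f h : 'End(V)) (b : {bilinear V -> V -> V}) x y :
    (forall z, f (h z) = h (f z)) ->
  gl_act f (gl_act h b) x y = gl_act h (gl_act f b) x y.
Proof.
have lin3 (k : 'End(V)) t1 t2 t3 : k (t1 - t2 - t3) = k t1 - k t2 - k t3.
  by rewrite !raddfB.
move=> fh; apply: (@dot_inj _ _ g) => z.
by rewrite /gl_act !lin3 !fh !dotBl; ring.
Qed.

Variable s : seq V.
Hypothesis sP : forall x, x = \sum_(e <- s) g x e *: e.

(** Cyclicity of the trace, tr(k^t h f) = tr(f k^t h), written without k^t: both sides equal the
    same double sum over the frame. *)
Lemma sum_frame_transpose f ft (h k : {linear V -> V}) :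
    transpose_of g f ft ->
  \sum_(e <- s) g (h (f e)) (k e) = \sum_(e <- s) g (h e) (k (ft e)).
Proof.
move=> fT; transitivity
    (\sum_(e <- s) \sum_(e' <- s) g e (ft e') * g (h e') (k e)).
  apply: eq_bigr => e _; rewrite {1}[f e]sP linear_sum /= linear_sumlz.
  by apply: eq_bigr => e' _; rewrite linearZ /= dotZl fT.
rewrite exchange_big; apply: eq_bigr => e' _ /=.
rewrite {2}[ft e']sP linear_sum [RHS]linear_sumr.
by apply: eq_bigr => e _; rewrite linearZ /= dotZr [g e _]dotC.
Qed.

Lemma sum_frame_eq0 (h : {linear V -> V}) :
  \sum_(e <- s) g (h e) (h e) = 0 -> forall x, h x = 0.
Proof.
move=> /eqP; rewrite psumr_eq0 => [/allP h0 x|e _]; last exact: dot_ge0.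
rewrite [x]sP linear_sum big_seq big1 // => e /h0/eqP/dot_eq0 he0.
by rewrite linearZ /= he0 scaler0.
Qed.

Definition hilbert_schmidt (b1 b2 : V -> V -> V) :=
  \sum_(e <- s) \sum_(e' <- s) g (b1 e e') (b2 e e').

Lemma hilbert_schmidt_eq0 (b : {bilinear V -> V -> V}) :
  hilbert_schmidt b b = 0 -> forall x y, b x y = 0.
Proof.
move=> /eqP; rewrite psumr_eq0 => [/allP b0 x y|e _]; last first.
  by apply: sumr_ge0 => e' _; exact: dot_ge0.
rewrite [x]sP linear_sumlz big_seq big1 // => e /b0/eqP/sum_frame_eq0 be0.
by rewrite linearZl_LR be0 scaler0.
Qed.

(** The outer factor transposes directly, the inner ones by cyclicity of the trace in one argument
    with the other fixed. *)
Lemma hilbert_schmidt_transpose f ft (b1 b2 : {bilinear V -> V -> V}) :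
    transpose_of g f ft ->
  hilbert_schmidt (gl_act f b1) b2 = hilbert_schmidt b1 (gl_act ft b2).
Proof.
move=> fT; rewrite /hilbert_schmidt /gl_act.
under eq_bigr do under eq_bigr do rewrite !dotBl.
under [RHS]eq_bigr do under eq_bigr do rewrite !dotBr.
under eq_bigr do rewrite !sumrB.
under [RHS]eq_bigr do rewrite !sumrB.
rewrite !sumrB; congr (_ - _ - _).
- by apply: eq_bigr => e _; apply: eq_bigr => e' _.
- rewrite exchange_big [RHS]exchange_big; apply: eq_bigr => e' _.
  exact: (@sum_frame_transpose _ _ (applyr b1 e') (applyr b2 e')).
- by apply: eq_bigr => e _; exact: (@sum_frame_transpose _ _ (b1 e) (b2 e)).
Qed.

(* |D^t.b|^2 = <D.D^t.b, b> = <D^t.D.b, b> = 0 for [b] the bracket. *)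
Lemma normal_derivation_transpose (br : {bilinear V -> V -> V}) D Dt :
    transpose_of g D Dt -> (forall z, D (Dt z) = Dt (D z)) ->
  derivation br D -> derivation br Dt.
Proof.
move=> DT DDt /derivation_gl_act Dbr0; apply/derivation_gl_act.
apply: (@hilbert_schmidt_eq0 (gl_act Dt br)).
rewrite (hilbert_schmidt_transpose _ _ (transpose_of_sym DT)).
rewrite /hilbert_schmidt big1 // => e _; rewrite big1 // => e' _.
by rewrite gl_act_comm // {1}/gl_act !Dbr0 linear0 !subr0 linear0r.
Qed.

(* tr(K^2) = tr(K P A) - tr(K A P) = 0 as K commutes with P. *)
Lemma commutator_eq0 (P A K : 'End(V)) :
    transpose_of g P P -> transpose_of g K K ->
    (forall z, K z = P (A z) - A (P z)) -> (forall z, P (K z) = K (P z)) ->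
  forall z, K z = 0.
Proof.
move=> PT KT KE PK; apply: sum_frame_eq0.
have KKE e : g (K e) (K e) = g (K (P (A e))) e - g (K (A (P e))) e.
  by rewrite -KT (KE e) raddfB dotBl.
under eq_bigr do rewrite KKE.
rewrite sumrB; apply/eqP; rewrite subr_eq0 eq_sym; apply/eqP.
rewrite (@sum_frame_transpose _ _ (K \o A) idfun PT) /=.
by apply: eq_bigr => e _; rewrite -PT PK.
Qed.

End Frame.

(** * Traces of endomorphisms *)

Section Trace.
Context {R : realType} {V : vectType R}.
Implicit Types f h A B J : 'End(V).

Lemma lftraceD f h : lftrace (f + h) = lftrace f + lftrace h.
Proof.
by rewrite /lftrace -[f]scale1r passmx.mxof_linear !scale1r mxtraceD.
Qed.

Lemma lftrace0 : lftrace (0 : 'End(V)) = 0.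
Proof. by apply: (addrI (lftrace (0 : 'End(V)))); rewrite -lftraceD !addr0. Qed.

Lemma lftraceN f : lftrace (- f) = - lftrace f.
Proof. by apply: (addrI (lftrace f)); rewrite -lftraceD !subrr lftrace0. Qed.

Lemma lftraceB f h : lftrace (f - h) = lftrace f - lftrace h.
Proof. by rewrite lftraceD lftraceN. Qed.

Lemma lftraceC f h : lftrace (f \o h)%VF = lftrace (h \o f)%VF.
Proof.
by rewrite /lftrace !(@passmx.mxof_comp _ _ _ _ _ _ _ (vbasisP _)) mxtrace_mulC.
Qed.

(* With A = ad X, A' = ad JX, B = ad Y and B' = ad JY, the first two hypotheses
   are the vanishing of the Nijenhuis tensor. *)
Lemma lftrace_comm_integrable J A A' B B' :
    (A' \o J = (J \o A') + A + (J \o A \o J))%VF ->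
    (B' \o J = (J \o B') + B + (J \o B \o J))%VF ->
    (J \o J = - \1)%VF ->
  lftrace (J \o ((A' \o B') - (B' \o A')))%VF =
  lftrace (J \o ((A \o B) - (B \o A)))%VF.
Proof.
move=> A'J B'J JJ.
(* Cyclicity brings [A'] in front of [J]; integrability then makes the two copies of tr(J A' B')
   cancel. *)
have trA' : lftrace (J \o ((A' \o B') - (B' \o A')))%VF =
    - lftrace (A \o B')%VF - lftrace (J \o A \o J \o B')%VF.
  rewrite comp_lfunDr comp_lfunNr lftraceB !comp_lfunA.
  rewrite [lftrace (J \o B' \o A')%VF]lftraceC comp_lfunA A'J.
  by rewrite !comp_lfunDl !lftraceD; ring.
(* The same for [B' \o J], after which J^2 = -1 simplifies the result. *)
have trB' : lftrace (J \o A \o J \o B')%VF =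
    - lftrace (A \o B')%VF + lftrace (J \o B \o A)%VF
    - lftrace (J \o A \o B)%VF.
  rewrite -!comp_lfunA lftraceC -!comp_lfunA B'J !comp_lfunDr !lftraceD.
  rewrite -[in X in _ + X = _]comp_lfunA ![(J \o (J \o _))%VF]comp_lfunA JJ.
  rewrite !comp_lfunNl !comp_lfun1l !comp_lfunNr !lftraceN; congr (_ + _ - _).
    by rewrite lftraceC comp_lfunA.
  by rewrite comp_lfunA lftraceC comp_lfunA.
by rewrite trA' trB' comp_lfunDr comp_lfunNr lftraceB !comp_lfunA; ring.
Qed.

End Trace.

(** * The Chern-Ricci form *)

Section ChernRicci.
Context {R : realType} {V : vectType R}.
Variables (br : {bilinear V -> V -> V}).
Implicit Types (w : {skew_symmetric V}) (J D P : 'End(V)).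

Lemma adE x y : ad br x y = br x y.
Proof. by rewrite lfunE. Qed.

Lemma adN x : ad br (- x) = - ad br x.
Proof. by apply/lfunP => z; rewrite opp_lfunE !adE linearNl. Qed.

Lemma adD x y : ad br (x + y) = ad br x + ad br y.
Proof. by apply/lfunP => z; rewrite add_lfunE !adE linearDl. Qed.

Hypothesis lie : lie_bracket br.

Lemma brC x y : br x y = - br y x.
Proof.
apply/eqP; rewrite -addr_eq0; apply/eqP.
by have := lie.1 (x + y); rewrite linearDl !linearD /= !lie.1 addr0 add0r.
Qed.

Lemma ad_br x y :
  ad br (br x y) = ((ad br x \o ad br y) - (ad br y \o ad br x))%VF.
Proof.
apply/lfunP => z; rewrite add_lfunE opp_lfunE !comp_lfunE !adE.
have := lie.2 x y z; rewrite [br z (br x y)]brC => /eqP.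
by rewrite subr_eq0 => /eqP <-; rewrite [br z x]brC linearN.
Qed.

Lemma lftrace_ad_br x y : lftrace (ad br (br x y)) = 0.
Proof. by rewrite ad_br lftraceB lftraceC subrr. Qed.

(** For a derivation, ad(D z) = [D, ad z]. As [D] commutes with [J], both J ad(D z) and ad(J D z) =
    ad(D J z) are traceless; this is applied to z = [x, y]. *)
Lemma chern_ricci_form_derivation J D x y :
    derivation br D -> (D \o J)%VF = (J \o D)%VF ->
  chern_ricci_form br J (D x) y + chern_ricci_form br J x (D y) = 0.
Proof.
move=> Dder DJ.
have adDz z : ad br (D z) = ((D \o ad br z) - (ad br z \o D))%VF.
  apply/lfunP => t; rewrite add_lfunE opp_lfunE !comp_lfunE !adE Dder.
  by rewrite addrK.
have tr1 z : lftrace (J \o ad br (D z))%VF = 0.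
  rewrite adDz comp_lfunDr comp_lfunNr lftraceB !comp_lfunA.
  by rewrite [X in _ - X]lftraceC comp_lfunA DJ subrr.
have tr2 z : lftrace (ad br (J (D z))) = 0.
  by rewrite -comp_lfunE -DJ comp_lfunE adDz lftraceB lftraceC subrr.
have := tr1 (br x y); have := tr2 (br x y); rewrite Dder raddfD !adD.
rewrite comp_lfunDr !lftraceD /chern_ricci_form => e1 e2.
rewrite addrACA -!mulrDr e1 e2 !mulr0 addr0//.
Qed.

Lemma chern_ricci_form_skew J x y :
  chern_ricci_form br J x y = - chern_ricci_form br J y x.
Proof.
rewrite /chern_ricci_form [br x y]brC raddfN !adN comp_lfunNr !lftraceN; ring.
Qed.

(** Integrability rewrites [J x, J y]. The first trace is the commutator computation above; in the
    second, the extra terms are ad of brackets, of trace 0. *)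
Lemma chern_ricci_form_invariant J x y :
    (J \o J)%VF = - \1%VF ->
    (forall x y,
        br (J x) (J y) - br x y - J (br (J x) y) - J (br x (J y)) = 0) ->
  chern_ricci_form br J (J x) (J y) = chern_ricci_form br J x y.
Proof.
move=> JJ integrable.
have brJ u v : br (J u) (J v) = br u v + J (br (J u) v) + J (br u (J v)).
  have /eqP := integrable u v; rewrite !subr_eq add0r => /eqP->.
  by rewrite addrC [X in _ + X]addrC addrA.
have adJ u : (ad br (J u) \o J =
    (J \o ad br (J u)) + ad br u + (J \o ad br u \o J))%VF.
  apply/lfunP => v; rewrite !add_lfunE !comp_lfunE !adE brJ.
  by rewrite [br u v + _]addrC.
rewrite /chern_ricci_form; congr (_ * _ + _ * _).
  by rewrite !ad_br (lftrace_comm_integrable (adJ x) (adJ y)).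
have JJE z : J (J z) = - z by rewrite -comp_lfunE JJ opp_lfunE id_lfunE.
rewrite brJ !raddfD /= !JJE !adD !adN !lftraceD !lftraceN.
by rewrite !lftrace_ad_br oppr0 !addr0.
Qed.
End ChernRicci.

(** * Complex eigenvectors of a real endomorphism *)

Section RealEigen.
Import passmx.

(* [u + i v] is an eigenvector of the complexification of [f], for [a + i b]. *)
Lemma rotation_eigenvectors (R : rcfType) (V : vectType R) (f : 'End(V)) :
  (0 < \dim {:V})%N ->
  exists a b : R, exists u v : V,
    [/\ (u != 0) || (v != 0), f u = a *: u - b *: v & f v = a *: v + b *: u].
Proof.
move=> V_gt0; set e := vbasis {:V}; have eb : basis_of {:V} e := vbasisP _.
have [z] :=
  eigenvalue_closed (map_mx (real_complex R) (passmx.mxof e e f)) V_gt0.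
case/eigenvalueP => x xE x_neq0.
pose xr := map_mx (@complex.Re R) x; pose xi := map_mx (@complex.Im R) x.
exists (complex.Re z), (complex.Im z).
exists (passmx.vecof e xr), (passmx.vecof e xi); split.
- rewrite !passmx.vecof_eq0// -negb_and; apply: contra x_neq0 => /andP[].
  move=> /eqP/rowP xr0 /eqP/rowP xi0; apply/eqP/rowP => i.
  apply/eqP; rewrite eq_complex; have := xr0 i; have := xi0 i.
  by rewrite !mxE /= => -> ->; rewrite eqxx.
- rewrite (passmx.hom_vecof e eb).
  (* The matrix is real, so real parts of the eigenvector equation can be taken entrywise; imaginary
     parts follow in the same way. *)
  have -> : xr *m passmx.mxof e e f = complex.Re z *: xr - complex.Im z *: xi.
    apply/rowP => i; have /rowP/(_ i)/(congr1 (@complex.Re R)) := xE.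
    rewrite !mxE raddf_sum /=; case: (z) (x 0 i) => [? ?] [? ?] /= <-.
    apply: eq_bigr => j _; rewrite !mxE.
    by case: (x 0 j) => ? ? /=; rewrite mulr0 subr0.
  by rewrite linearB !linearZ.
- rewrite (passmx.hom_vecof e eb).
  have -> : xi *m passmx.mxof e e f = complex.Re z *: xi + complex.Im z *: xr.
    apply/rowP => i; have /rowP/(_ i)/(congr1 (@complex.Im R)) := xE.
    rewrite !mxE raddf_sum /=; case: (z) (x 0 i) => [? ?] [? ?] /= <-.
    apply: eq_bigr => j _; rewrite !mxE.
    by case: (x 0 j) => ? ? /=; rewrite mulr0 add0r.
  by rewrite linearD !linearZ.
Qed.

End RealEigen.

(** * Properties of the Chern-Ricci operator *)

Section Hermitian.
Context {R : realType} {V : vectType R}.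
Variables (br : {bilinear V -> V -> V}) (w : {skew_symmetric V}).
Variables (g : {dot V for idfun}) (J P : 'End(V)).
Hypotheses (lie : lie_bracket br) (herm : hermitian_structure br w g J).
Hypothesis PE : chern_ricci_operator br w J P.

Lemma hermitian_JJ x : J (J x) = - x.
Proof.
by case: herm => _ _ JJ _; rewrite -comp_lfunE JJ opp_lfunE id_lfunE.
Qed.

Lemma hermitian_wE x y : w x y = g (J x) y.
Proof. by case: herm. Qed.

Lemma hermitian_J_skew x y : g (J x) y = - g x (J y).
Proof.
by rewrite -hermitian_wE hermC expr1 mulN1r /= hermitian_wE dotC.
Qed.

Lemma hermitian_w_inj x y : (forall z, w x z = w y z) -> x = y.
Proof.
move=> exy; have /(congr1 J) : J x = J y.
  by apply: (@dot_inj _ _ g) => z; rewrite -!hermitian_wE.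
by rewrite !hermitian_JJ => /oppr_inj.
Qed.

Lemma hermitian_wJ x y : w (J x) (J y) = w x y.
Proof. by rewrite !hermitian_wE hermitian_J_skew hermitian_JJ dotNr opprK. Qed.

(** Both p and [w] are invariant under [J]; writing the second argument as J(J(-z)) lets this be
    used. *)
Lemma chern_ricci_operator_J x : P (J x) = J (P x).
Proof.
case: herm => _ _ JJ integrable; apply: hermitian_w_inj => z.
rewrite -[z]opprK -hermitian_JJ -PE chern_ricci_form_invariant//.
by rewrite PE hermitian_wJ.
Qed.

(** Skew-symmetry of p at (J x, y), combined with P J = J P and J^2 = -1. *)
Lemma chern_ricci_operator_sym : transpose_of g P P.
Proof.
move=> x y; have := chern_ricci_form_skew lie J (J x) y.
rewrite !PE !hermitian_wE chern_ricci_operator_J hermitian_JJ dotNl.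
rewrite hermitian_J_skew hermitian_JJ dotNr opprK [g (P y) _]dotC.
exact: oppr_inj.
Qed.

(** Since [J] is skew for [g], D^t commutes with [J] too. Hence p(x, D y) = g(J P x, D y) = w(D^t P
    x, y), while p(x, D y) = - p(D x, y). *)
Lemma chern_ricci_operator_derivation D Dt x :
    derivation br D -> (D \o J)%VF = (J \o D)%VF -> transpose_of g D Dt ->
  P (D x) = - Dt (P x).
Proof.
move=> Dder DJ DT; have DJE z : D (J z) = J (D z) by rewrite -!comp_lfunE DJ.
have DtJ z : Dt (J z) = J (Dt z).
  apply: (@dot_inj _ _ g) => y.
  rewrite (transpose_of_sym DT) !hermitian_J_skew (transpose_of_sym DT).
  by rewrite DJE.
have wN u v : w (- u) v = - w u v by exact: linearNl.
apply: hermitian_w_inj => y; rewrite wN.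
have -> : w (Dt (P x)) y = chern_ricci_form br J x (D y).
  by rewrite PE !hermitian_wE -DtJ (transpose_of_sym DT).
by apply/eqP; rewrite -addr_eq0 -PE chern_ricci_form_derivation.
Qed.

End Hermitian.

(** * Consequences of the soliton equation *)

Section Soliton.
Context {R : realType} {V : vectType R}.
Variables (g : {dot V for idfun}) (P D Dt : 'End(V)) (c : R).
Hypothesis PT : transpose_of g P P.
Hypothesis PE : P = c *: \1%VF + 2^-1 *: (D + Dt).
Hypothesis PD : forall x, P (D x) = - Dt (P x).

Lemma soliton_square x : P (P x) = c *: P x.
Proof.
pose S : 'End(V) := P - c *: \1%VF.
(* As D^t = 2 P - 2 c - D, the relation P D = - D^t P reads [P, D] = -2 P S; the factor -1/2 gives
   [P, A] = P S. *)
pose A : 'End(V) := (- 2^-1) *: D.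
pose K : 'End(V) := (P \o S)%VF.
have [s _ sP] := orthonormal_frame g {:V}.
have {}sP y : y = \sum_(e <- s) g y e *: e by apply: sP; rewrite memvf.
have SE z : S z = P z - c *: z.
  by rewrite add_lfunE opp_lfunE scale_lfunE id_lfunE.
have KE z : K z = P (P z) - c *: P z by rewrite comp_lfunE SE linearB linearZ.
have PEz z : P z = c *: z + 2^-1 *: (D z + Dt z).
  by rewrite PE add_lfunE !scale_lfunE id_lfunE add_lfunE.
have DtE z : Dt z = 2 *: P z - (2 * c) *: z - D z.
  apply: (@dot_inj _ _ g) => t.
  by rewrite PEz !(dotBl, dotDl, dotZl); field.
apply/eqP; rewrite -subr_eq0 -KE; apply/eqP.
apply: (commutator_eq0 sP (P := P) (A := A) (K := K)) => // [y z|z|z].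
- by rewrite !KE !(dotBl, dotBr) dotZl dotZr !PT.
- apply: (@dot_inj _ _ g) => t.
  rewrite /A !scale_lfunE [P (_ *: _)]linearZ /= PD DtE KE.
  by rewrite !(dotBl, dotZl, dotNl); field.
- by rewrite !KE linearB linearZ.
Qed.

(** By P^2 = c P, the commutator [P, D] = -2 (P^2 - c P) vanishes, and D^t = 2 P - 2 c - D combines
    operators commuting with [D]. *)
Lemma soliton_transpose_comm x : D (Dt x) = Dt (D x).
Proof.
have DtE z : Dt z = 2 *: P z - (2 * c) *: z - D z.
  apply: (@dot_inj _ _ g) => t.
  rewrite PE add_lfunE !scale_lfunE id_lfunE add_lfunE.
  by rewrite !(dotBl, dotDl, dotZl); field.
have DP z : D (P z) = P (D z).
  apply: (@dot_inj _ _ g) => t; rewrite PD DtE soliton_square.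
  by rewrite !(dotBl, dotNl, dotZl); ring.
by rewrite !DtE linearB linearB !linearZ /= DP.
Qed.

Lemma soliton_derivation (br : {bilinear V -> V -> V}) :
    transpose_of g D Dt -> derivation br D ->
  derivation br (P - c *: \1%VF).
Proof.
move=> DT Dder; have [s _ sP] := orthonormal_frame g {:V}.
have {}sP y : y = \sum_(e <- s) g y e *: e by apply: sP; rewrite memvf.
have Dtder := normal_derivation_transpose sP DT soliton_transpose_comm Dder.
have -> : P - c *: \1%VF = 2^-1 *: (D + Dt) by rewrite PE addrAC subrr add0r.
move=> x y; rewrite !scale_lfunE !add_lfunE Dder Dtder.
rewrite linearZl_LR linearZr_LR /= linearDl linearDr -scalerDr.
by rewrite [in RHS]addrACA.
Qed.

End Soliton.

(** * Spectrum of a symmetric operator *)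

Section Symmetric.
Context {R : realType} {V : vectType R}.
Variables (g : {dot V for idfun}) (P : 'End(V)) (c : R).
Hypothesis PT : transpose_of g P P.

Lemma leigenvalueP a :
  reflect (exists2 x, x != 0 & P x = a *: x) (passmx.leigenvalue P a).
Proof.
have memE x : (x \in passmx.leigenspace P a) = (P x == a *: x).
  by rewrite memv_ker add_lfunE opp_lfunE scale_lfunE id_lfunE subr_eq0.
apply: (iffP idP) => [E0|[x x0 Px]]; last first.
  apply: contraNneq x0 => E0; rewrite -memv0 -E0 memE Px//.
exists (vpick (passmx.leigenspace P a)); first by rewrite vpick0.
by apply/eqP; rewrite -memE memv_pick.
Qed.

(** For u + i v a complex eigenvector of the restriction, with eigenvalue a + i b, symmetry gives b
    (|u|^2 + |v|^2) = 0. So b = 0, and [u] or [v] is a real eigenvector. *)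
Lemma stable_symmetric_eigenvector (W : {vspace V}) :
    W != 0%VS -> {in W, forall x, P x \in W} ->
  exists a x, [/\ x != 0, x \in W & P x = a *: x].
Proof.
move=> W0 PW; pose f : 'End(subvs_of W) := linfun (vsproj W \o P \o vsval).
have fE u : vsval (f u) = P (vsval u).
  by rewrite lfunE /= vsprojK// PW// subvsP.
have dim_gt0 : (0 < \dim {:subvs_of W})%N by rewrite dimvf lt0n dimv_eq0.
have [a [b [u [v [uv0 fu fv]]]]] := rotation_eigenvectors f dim_gt0.
have {fu} Pu : P (vsval u) = a *: vsval u - b *: vsval v.
  by rewrite -fE fu raddfB.
have {fv} Pv : P (vsval v) = a *: vsval v + b *: vsval u.
  by rewrite -fE fv raddfD.
have {}uv0 : (vsval u != 0) || (vsval v != 0).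
  by move: uv0; rewrite -!(inj_eq val_inj).
have b0 : b = 0.
  have := PT (vsval u) (vsval v); rewrite Pu Pv dotBl dotDr !dotZl !dotZr.
  move=> e; have /eqP : b * (g (vsval u) (vsval u) + g (vsval v) (vsval v)) = 0.
    by lra.
  rewrite mulf_eq0 => /orP[/eqP//|]; rewrite gt_eqF//.
  by case/orP: uv0 => /(dot_gt0 g); [apply: ltr_wpDr|apply: ltr_wpDl];
    apply: dot_ge0.
rewrite b0 !scale0r subr0 addr0 in Pu Pv; exists a.
by case/orP: uv0 => t0; [exists (vsval u)|exists (vsval v)]; split;
  rewrite ?subvsP.
Qed.

(** Diagonalisation is avoided: if the image of Q = P^2 - c P were nonzero, it would contain an
    eigenvector t = Q y of [P], killed by [Q], and g(t, t) = g(y, Q t) = 0. *)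
Lemma symmetric_two_eigenvalues :
    (forall a, passmx.leigenvalue P a -> a = 0 \/ a = c) ->
  forall x, P (P x) = c *: P x.
Proof.
move=> eigP x; pose Q : 'End(V) := (P \o P)%VF - c *: P.
have QE y : Q y = P (P y) - c *: P y.
  by rewrite add_lfunE opp_lfunE scale_lfunE comp_lfunE.
have [W0|W0] := eqVneq (limg Q) 0%VS.
  have : Q x \in limg Q by rewrite memv_img ?memvf.
  by rewrite W0 memv0 QE subr_eq0 => /eqP.
exfalso; have PW : {in limg Q, forall y, P y \in limg Q}.
  move=> _ /memv_imgP[y _ ->]; have -> : P (Q y) = Q (P y).
    by rewrite !QE linearB linearZ.
  by rewrite memv_img ?memvf.
have [a [t [t0 tW Pt]]] := stable_symmetric_eigenvector W0 PW.
have QT : transpose_of g Q Q.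
  by move=> y z; rewrite !QE dotBl dotBr dotZl dotZr !PT.
have Qt : Q t = 0.
  rewrite QE Pt linearZ /= Pt !scalerA -scalerBl.
  case: (eigP a) => [|->|->]; first by apply/leigenvalueP; exists t.
    by rewrite mul0r mulr0 subrr scale0r.
  by rewrite subrr scale0r.
case/memv_imgP: tW => y _ tE; case/negP: t0; apply/eqP/(@dot_eq0 _ _ g).
by rewrite {1}tE QT Qt linear0r.
Qed.

End Symmetric.

(** * The splitting defined by P^2 = c P *)

Section TwoEigenvalues.
Context {R : realType} {V : vectType R}.
Variables (g : {dot V for idfun}) (P : 'End(V)) (c : R).
Hypothesis PT : transpose_of g P P.
Hypothesis P2 : forall x, P (P x) = c *: P x.
Hypothesis P0 : P <> 0.

(** If c = 0, then g(P x, P x) = g(x, P^2 x) = 0. *)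
Lemma eigenvalue_neq0 : c != 0.
Proof.
apply/eqP => c0; apply: P0; apply/lfunP => x; rewrite zero_lfunE.
by apply: (@dot_eq0 _ _ g); rewrite PT P2 c0 scale0r linear0r.
Qed.

Let cN0 := eigenvalue_neq0.

(** The operator c^-1 P is a projection; x - c^-1 P x and c^-1 P x are the two components of [x]. *)
Lemma proj_lker x : P (x - c^-1 *: P x) = 0.
Proof. by rewrite linearB linearZ /= P2 scalerA mulVf// scale1r subrr. Qed.

Lemma proj_eigenspace x : P (c^-1 *: P x) = c *: (c^-1 *: P x).
Proof. by rewrite linearZ /= P2 !scalerA mulrC. Qed.

(** A vector orthogonal to the kernel is orthogonal to its own kernel component, which therefore
    vanishes. Conversely, eigenvectors for c and 0 are orthogonal as c is nonzero. *)
Lemma orthov_lker : orthov g (lker P) = passmx.leigenspace P c.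
Proof.
apply/vspaceP => x; rewrite [RHS]memv_ker add_lfunE opp_lfunE scale_lfunE.
rewrite id_lfunE subr_eq0; apply/mem_orthovP/eqP => [xk|Px y].
  have kx : x - c^-1 *: P x \in lker P by rewrite memv_ker proj_lker.
  have : x - c^-1 *: P x = 0.
    apply: (@dot_eq0 _ _ g); rewrite dotBl dotZl PT proj_lker.
    by rewrite linear0r mulr0 subr0; exact: xk.
  by move=> /subr0_eq xE; rewrite [in RHS]xE scalerA mulfV// scale1r.
rewrite memv_ker => /eqP Py; apply: (mulfI cN0).
by rewrite -[LHS]dotZl -Px PT Py linear0r mulr0.
Qed.

Lemma mem_orthov_lker x : (x \in orthov g (lker P)) = (P x == c *: x).
Proof.
rewrite orthov_lker memv_ker add_lfunE opp_lfunE scale_lfunE.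
by rewrite id_lfunE subr_eq0.
Qed.

Lemma lker_orthov_full : (orthov g (lker P) + lker P)%VS = fullv.
Proof.
apply/vspaceP => x; rewrite memvf; apply/memv_addP.
exists (c^-1 *: P x); first by rewrite mem_orthov_lker proj_eigenspace.
by exists (x - c^-1 *: P x); rewrite ?memv_ker ?proj_lker// addrC subrK.
Qed.

Lemma lker_orthov_disjoint : (orthov g (lker P) :&: lker P)%VS = 0%VS.
Proof.
apply/eqP; rewrite -subv0; apply/subvP => x.
rewrite memv_cap mem_orthov_lker memv_ker memv0 => /andP[/eqP-> ].
by rewrite scaler_eq0 (negPf cN0).
Qed.

Variable br : {bilinear V -> V -> V}.

(** The identity map fails the Leibniz rule by one copy of the bracket, hence the term - c
    [x, y]. *)
Lemma derivation_shiftP :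
  derivation br (P - c *: \1%VF) <->
  forall x y, P (br x y) = br (P x) y + br x (P y) - c *: br x y.
Proof.
have shE z : (P - c *: \1%VF) z = P z - c *: z.
  by rewrite add_lfunE opp_lfunE scale_lfunE id_lfunE.
by split=> Pder x y; have := Pder x y;
  rewrite ?shE linearBl linearBr linearZl_LR linearZr_LR /= => e;
  apply: (@dot_inj _ _ g) => z; move: (congr1 (g^~ z) e);
  rewrite !(dotBl, dotDl, dotZl) => ?; lra.
Qed.

(** For eigenvalues a and b, P [x, y] = (a + b - c) [x, y]: c and c give c, while 0 and 0 give -c,
    which is not an eigenvalue. *)
Lemma derivation_splitting :
    derivation br (P - c *: \1%VF) ->
  [/\ forall a, passmx.leigenvalue P a -> a = 0 \/ a = c,
      lie_ideal br (lker P), lie_abelian br (lker P)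
    & lie_subalgebra br (orthov g (lker P))].
Proof.
move=> /derivation_shiftP Pder.
have kab : lie_abelian br (lker P).
  move=> x y; rewrite !memv_ker => /eqP Px /eqP Py.
  have := Pder x y; rewrite Px Py linear0l linear0r addr0 add0r => Pb.
  have := P2 (br x y); rewrite Pb linearN linearZ /= Pb !scalerN opprK scalerA.
  move=> /eqP; rewrite -addr_eq0 -scalerDl scaler_eq0 -mulr2n mulrn_eq0 /=.
  by rewrite mulf_eq0 (negPf cN0) => /eqP.
split=> //.
- move=> a /leigenvalueP[x x0 Px]; have := P2 x.
  rewrite Px linearZ /= Px !scalerA.
  move=> /eqP; rewrite -subr_eq0 -scalerBl scaler_eq0 (negPf x0) orbF -mulrBl.
  by rewrite mulf_eq0 subr_eq0 => /orP[] /eqP; [right|left].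
- move=> x y yk; have := yk; rewrite !memv_ker => /eqP Py.
  (* P [x, y] = [P x - c x, y], and P x - c x lies in the kernel, already known to be abelian. *)
  rewrite Pder Py linear0r addr0 -linearZl_LR -linearBl kab//.
  by rewrite memv_ker linearB linearZ /= P2 subrr.
- move=> x y; rewrite !mem_orthov_lker => /eqP Px /eqP Py.
  by rewrite Pder Px Py linearZl_LR linearZr_LR /= addrK.
Qed.

(** By bilinearity the Leibniz rule is checked on components, whose brackets lie in the
    c-eigenspace, lie in the kernel, or vanish. *)
Lemma splitting_derivation :
    lie_ideal br (lker P) -> lie_abelian br (lker P) ->
    lie_subalgebra br (orthov g (lker P)) -> (forall x y, br x y = - br y x) ->
  derivation br (P - c *: \1%VF).
Proof.
move=> kid kab hsub brC; apply/derivation_shiftP => x y.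
have split_sum z : exists u v, [/\ z = u + v, P u = c *: u & P v = 0].
  exists (c^-1 *: P z), (z - c^-1 *: P z); split.
  - by rewrite addrC subrK.
  - exact: proj_eigenspace.
  - exact: proj_lker.
have [a [b [-> Pa Pb]]] := split_sum x.
have [a' [b' [-> Pa' Pb']]] := split_sum y.
have kid' u v : P v = 0 -> P (br u v) = 0.
  by move=> Pv; apply/eqP; rewrite -memv_ker kid// memv_ker Pv.
have P1 : P (br a a') = c *: br a a'.
  by apply/eqP; rewrite -mem_orthov_lker hsub// mem_orthov_lker ?Pa ?Pa'.
have bb' : br b b' = 0 by rewrite kab// memv_ker ?Pb ?Pb'.
(* [lie_ideal] has the element of the ideal on the right; skew-symmetry covers the left. *)
have Pba' : P (br b a') = 0 by rewrite brC linearN /= kid'// oppr0.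
rewrite !linearD /= Pa Pb Pa' Pb' !addr0 !linearDl /= !linearD /=.
rewrite P1 Pba' kid'// bb'.
rewrite !linear0r linear0 !linearZl_LR !linearZr_LR /=.
apply: (@dot_inj _ _ g) => z; have g0 : g 0 z = 0 by exact: linear0l.
by rewrite !(dotBl, dotDl, dotZl, dotNl, g0); ring.
Qed.

End TwoEigenvalues.

(** * Equivalence of the conditions *)

Section Main.
Context {R : realType} {V : vectType R}.
Variables (br : {bilinear V -> V -> V}) (w : {skew_symmetric V}).
Variables (g : {dot V for idfun}) (J P : 'End(V)) (c : R).
Hypotheses (lie : lie_bracket br) (herm : hermitian_structure br w g J).
Hypothesis PE : chern_ricci_operator br w J P.

Lemma chern_ricci_solitonP :
  chern_ricci_soliton br g J P c <-> derivation br (P - c *: \1%VF).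
Proof.
have PT := chern_ricci_operator_sym lie herm PE.
split=> [[D [Dt [Dder DJ DT PDDt]]]|Dder].
  apply: (soliton_derivation PT PDDt _ DT Dder) => x.
  exact: (chern_ricci_operator_derivation herm PE).
pose D := P - c *: \1%VF.
have DE x : D x = P x - c *: x.
  by rewrite add_lfunE opp_lfunE scale_lfunE id_lfunE.
(* P - c is symmetric, hence its own transpose. *)
exists D, D; split=> //.
- apply/lfunP => x; rewrite !comp_lfunE !DE.
  by rewrite (chern_ricci_operator_J lie herm PE) [RHS]linearB [in RHS]linearZ.
- by move=> x y; rewrite !DE dotBl dotBr dotZl dotZr PT.
- by rewrite -mulr2n -scaler_nat scalerA mulVf ?pnatr_eq0// scale1r addrC subrK.
Qed.

Lemma chern_ricci_soliton_square x :
  chern_ricci_soliton br g J P c -> P (P x) = c *: P x.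
Proof.
case=> D [Dt [Dder DJ DT PDDt]].
apply: (soliton_square (chern_ricci_operator_sym lie herm PE) PDDt) => y.
exact: (chern_ricci_operator_derivation herm PE).
Qed.

End Main.

Theorem proposition8p2 (R : realType) (V : vectType R) (n : nat)
    (br : {bilinear V -> V -> V}) (w : {skew_symmetric V})
    (g : {dot V for idfun}) (J P : 'End(V)) (c : R) :
  \dim {:V} = (2 * n)%N ->
  lie_bracket br ->
  hermitian_structure br w g J ->
  chern_ricci_operator br w J P ->
  P <> 0 ->
  let cond_i := chern_ricci_soliton br g J P c in
  let cond_ii := exists D : 'End(V), derivation br D /\ P = c *: \1%VF + D in
  let k := lker P in
  let kperp := orthov g k in
  let cond_iii :=
    [/\ forall a, passmx.leigenvalue P a -> a = 0 \/ a = c,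
        lie_ideal br k,
        lie_abelian br k
      & lie_subalgebra br kperp] in
  [/\ cond_i <-> cond_ii,
      cond_ii <-> cond_iii
    & cond_iii -> [/\ kperp = passmx.leigenspace P c,
                      lie_semidirect br kperp k & c <> 0]].
Proof.
move=> _ lie herm PE P0 cond_i cond_ii k kperp cond_iii.
have PT := chern_ricci_operator_sym lie herm PE.
have iE := chern_ricci_solitonP c lie herm PE.
(* Condition (ii) leaves no choice: [D] must be P - c. *)
have iiE : cond_ii <-> derivation br (P - c *: \1%VF).
  split=> [[D [Dder PD]]|Dder].
    by have -> : P - c *: \1%VF = D by rewrite PD addrAC subrr add0r.
  by exists (P - c *: \1%VF); split=> //; rewrite addrC subrK.
split.
- by split=> [/iE/iiE|/iiE/iE].
- split=> [/iiE Dder|[eigP kid kab hsub]].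
    apply: (derivation_splitting PT _ P0 Dder) => x.
    (* P^2 = c P comes from the soliton condition, which holds with D = P - c. *)
    by apply: (chern_ricci_soliton_square lie herm PE); apply/iE.
  apply/iiE/(splitting_derivation PT _ P0 kid kab hsub); last exact: brC.
  exact: symmetric_two_eigenvalues PT eigP.
- case=> eigP kid kab hsub; have P2 := symmetric_two_eigenvalues PT eigP.
  split; last exact/eqP/(eigenvalue_neq0 PT P2 P0).
    exact: (orthov_lker PT P2 P0).
  split=> //; first exact: (lker_orthov_full PT P2 P0).
  exact: (lker_orthov_disjoint PT P2 P0).
Qed.
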